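(* Let $\mathcal G=(G,p,\theta,\tau)$ be a well-positioned and $\Gamma$-symmetric bar-joint framework in $X$. Then the complexified framework complex of $(G,p)$ is the direct sum of the $\chi$-symmetric framework complexes of $\mathcal G$: $$\mathrm{comp}_{\mathbb C}(G,p)=\bigoplus_{\chi\in\hat\Gamma}\mathrm{comp}_\chi(\mathcal G).$$
   Context: $X$ is a finite dimensional real vector space with a norm $\|\cdot\|$ and $\dim X\ge 2$; $\mathrm{Isom}(X)$ is its group of linear isometries; $X_{\mathbb C}=\mathbb C\otimes_{\mathbb R}X$. $\Gamma$ is a finite abelian group with identity $1$, and $\hat\Gamma$ is its group of characters $\chi:\Gamma\to\{z\in\mathbb C:|z|=1\}$. A real linear map and its complex-linear extension to complexifications are denoted by the same symbol. A $\Gamma$-symmetric graph is a pair $(G,\theta)$ with $G=(V,E)$ a finite simple undirected graph and $\theta:\Gamma\to\mathrm{Aut}(G)$ a homomorphism acting freely on $V$; write $\gamma v$ for $\theta(\gamma)v$ and $\gamma e$ for the edge joining $\gamma v,\gamma w$ if $e=vw$. A bar-joint framework in $X$ is a pair $(G,p)$ with $p=(p_v)_{v\in V}\in X^V$ having distinct components. It is well-positioned if $f_G:X^V\to\mathbb R^E$, $(x_v)\mapsto(\|x_v-x_w\|)_{vw\in E}$, is differentiable at $p$, with differential $df_G(p)$. A $\Gamma$-symmetric bar-joint framework is a tuple $\mathcal G=(G,p,\theta,\tau)$ with $(G,p)$ a bar-joint framework, $(G,\theta)$ a $\Gamma$-symmetric graph and $\tau:\Gamma\to\mathrm{Isom}(X)$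 a representation with $\tau(\gamma)p_v=p_{\gamma v}$ for all $\gamma,v$. A rigid motion of $X$ is a family of continuous paths $\{\alpha_x:[-1,1]\to X\}_{x\in X}$ with $\alpha_x(0)=x$ and $\|\alpha_x(t)-\alpha_y(t)\|=\|x-y\|$ for all $x,y\in X$, $t\in[-1,1]$. An infinitesimal rigid motion is a vector field $\eta:X\to X$ with $\eta(x)=\alpha_x'(0)$ for all $x$, for some rigid motion. $\mathcal T(X)$ is the vector space of all infinitesimal rigid motions and $\mathcal T(X;\mathbb C)$ is the complex span of the fields $X\to X_{\mathbb C}$, $x\mapsto 1\otimes\eta(x)$, $\eta\in\mathcal T(X)$. The restriction map is $\rho_{(G,p)}:\mathcal T(X;\mathbb C)\to (X_{\mathbb C})^V$, $\eta\mapsto(\eta(p_v))_{v\in V}$. $\mathrm{comp}_{\mathbb C}(G,p)$ is the chain complex $0\to\mathcal T(X;\mathbb C)\xrightarrow{\rho_{(G,p)}}(X_{\mathbb C})^V\xrightarrow{df_G(p)}\mathbb C^E\to0$. For $\chi\in\hat\Gamma$: $X_\chi=\{x\in(X_{\mathbb C})^V:x_{\gamma v}=\chi(\gamma)\tau(\gamma)x_v\ \forall\gamma\in\Gamma,v\in V\}$, $Y_\chi=\{y\in\mathbb C^E:y_{\gamma e}=\chi(\gamma)y_e\ \forall\gamma\in\Gamma,e\in E\}$, $\mathcal T_\chi(X)=\{\eta\in\mathcal T(X;\mathbb C):\eta(\tau(\gamma)x)=\chi(\gamma)\tau(\gamma)\eta(x)\ \forall\gamma\in\Gamma,x\in X\}$.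 The map $\rho_\chi(\mathcal G):\mathcal T_\chi(X)\to X_\chi$ is the restriction of $\rho_{(G,p)}$ and $R_\chi(\mathcal G):X_\chi\to Y_\chi$ is the restriction of $df_G(p)$. $\mathrm{comp}_\chi(\mathcal G)$ is the chain complex $0\to\mathcal T_\chi(X)\xrightarrow{\rho_\chi(\mathcal G)}X_\chi\xrightarrow{R_\chi(\mathcal G)}Y_\chi\to0$. The asserted equality means that each of the three spaces is the (internal) direct sum of the corresponding subspaces over $\chi\in\hat\Gamma$, and that the two maps are the corresponding direct sums of maps. *)

(* Defs.v *)
From HB Require Import structures.
From mathcomp Require Import all_boot all_order all_fingroup all_algebra.
From mathcomp Require Import complex.
From mathcomp Require Import all_classical all_reals all_analysis.

Set Implicit Arguments.
Unset Strict Implicit.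
Unset Printing Implicit Defensive.

Import Order.TTheory GRing.Theory Num.Theory.
Import numFieldNormedType.Exports.

Local Open Scope classical_set_scope.
Local Open Scope ring_scope.

#[short(type="normedVectType")]
HB.structure Definition NormedVector (K : numFieldType) :=
  {V of NormedModule K V & Vector K V}.

(* X^I carries the sup norm, like matrices in the library. It only serves to
   make sense of differentials; for finite dimensional X any other norm on X^I
   yields the same ones. *)
Section FfunNorm.
Context {R : realFieldType} {I : finType} {X : normedModType R}.
Implicit Types f g : {ffun I -> X}.

Definition ffun_norm f : R := \big[Order.max/0]_i `|f i|.

Lemma ler_ffun_normD f g : ffun_norm (f + g) <= ffun_norm f + ffun_norm g.
Proof.
have ge0 h : 0 <= ffun_norm h by exact: bigmax_ge_id.
apply/bigmax_leP; split => [|i _]; first exact: addr_ge0.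
rewrite ffunE; apply: le_trans (ler_normD _ _) _.
by apply: lerD; apply: le_bigmax.
Qed.

Lemma ffun_normZ (a : R) f : ffun_norm (a *: f) = `|a| * ffun_norm f.
Proof.
rewrite /ffun_norm (eq_bigr (fun i => `|a| * `|f i|)); last first.
  by move=> i _; rewrite ffunE normrZ.
elim/big_ind2 : _ => [|x y u v -> ->|//]; first by rewrite mulr0.
by rewrite maxr_pMr.
Qed.

Lemma ffun_norm_eq0 f : ffun_norm f = 0 -> f = 0.
Proof.
move=> f0; apply/ffunP => i; rewrite ffunE; apply/eqP.
rewrite -normr_eq0 eq_le normr_ge0 andbT -f0.
exact: (le_bigmax _ (fun i => `|f i|)).
Qed.

End FfunNorm.

HB.instance Definition _ (R : realFieldType) (I : finType)
    (X : normedModType R) := Lmodule_isNormed.Build R {ffun I -> X}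
  ler_ffun_normD ffun_normZ ffun_norm_eq0.

(* C (x)_R X, with (x, y) standing for 1 (x) x + i (x) y. *)
Definition complexification (R : realType) (X : lmodType R) : Type :=
  (X * X)%type.

Section Complexification.
Context {R : realType} {X : lmodType R}.

HB.instance Definition _ :=
  GRing.Zmodule.copy (complexification X) (X * X)%type.

Definition cpx_scale (c : R[i]) (z : complexification X) :
    complexification X :=
  (complex.Re c *: z.1 - complex.Im c *: z.2,
   complex.Re c *: z.2 + complex.Im c *: z.1).

Let cscaleA a b z : cpx_scale a (cpx_scale b z) = cpx_scale (a * b) z.
Proof.
case: a b z => [a1 a2] [b1 b2] [x y]; rewrite /cpx_scale /=; congr (_, _).
  rewrite !scalerBr !scalerDr scalerBl scalerDl !scalerA.
  by rewrite !opprD [RHS]addrACA; congr (_ + _); rewrite addrC.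
rewrite !scalerBr !scalerDr scalerBl scalerDl !scalerA.
by rewrite [RHS]addrACA; congr (_ + _); rewrite addrC.
Qed.

Let cscale1 : left_id 1 cpx_scale.
Proof.
by case=> x y; rewrite /cpx_scale /= !scale1r !scale0r subr0 addr0.
Qed.

Let cscaleDr : right_distributive cpx_scale +%R.
Proof.
move=> c [x y] [x' y']; rewrite /cpx_scale /=; congr (_, _) => /=.
  by rewrite !scalerDr opprD addrACA.
by rewrite !scalerDr addrACA.
Qed.

Let cscaleDl z : {morph cpx_scale^~ z : a b / a + b}.
Proof.
case: z => x y [a1 a2] [b1 b2]; rewrite /cpx_scale /=; congr (_, _) => /=.
  by rewrite !scalerDl opprD addrACA.
by rewrite !scalerDl addrACA.
Qed.

HB.instance Definition _ := GRing.Zmodule_isLmodule.Build R[i]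
  (complexification X) cscaleA cscale1 cscaleDr cscaleDl.

Definition one_tensor (x : X) : complexification X := (x, 0).

Definition cpx_ext (f : X -> X) (z : complexification X) :
    complexification X :=
  (f z.1, f z.2).

End Complexification.

Record graph := Graph {
  vertex :> finType;
  edges : {set {set vertex}};
  edges_card2 : forall e, e \in edges -> #|e| = 2%N }.

Definition edge (G : graph) := {e : {set G} | e \in edges G}.

HB.instance Definition _ (G : graph) := Finite.on (edge G).

Definition ends (G : graph) (e : edge G) : option (G * G) :=
  [pick vw : G * G | val e == [set vw.1; vw.2]%SET].

Record framework (R : realType) (X : normedVectType R) := Framework {
  fr_graph :> graph;
  place : {ffun fr_graph -> X};
  place_inj : injective place }.

Section Rigidity.
Context {R : realType} {X : normedVectType R}.

Definition edge_lengths (G : graph) (x : {ffun G -> X}) : {ffun edge G -> R} :=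
  [ffun e => if ends e is Some (v, w) then `|x v - x w| else 0].

Lemma edge_lengthsE (G : graph) (x : {ffun G -> X}) (e : edge G) (v w : G) :
  val e = [set v; w]%SET -> edge_lengths x e = `|x v - x w|.
Proof.
move=> evw; rewrite ffunE /ends; case: pickP => [[a b] /= /eqP|/(_ (v, w))];
  last by rewrite evw eqxx.
have := edges_card2 (valP e); rewrite evw cards2; case: eqVneq => // vw _.
rewrite evw => ab.
have : a \in [set v; w]%SET by rewrite ab !inE eqxx.
have : b \in [set v; w]%SET by rewrite ab !inE eqxx orbT.
have : v \in [set a; b]%SET by rewrite -ab !inE eqxx.
have : w \in [set a; b]%SET by rewrite -ab !inE eqxx orbT.
rewrite !inE => /orP[]/eqP wa /orP[]/eqP va; subst; rewrite ?eqxx // in vw *.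
by rewrite distrC.
Qed.

Definition well_positioned (F : framework X) : Prop :=
  differentiable (@edge_lengths F) (place F).

(* The complex-linear extension of the differential of edge_lengths at the
   placement, under (X^V)_C = (X_C)^V and (R^E)_C = C^E. *)
Definition dlengths (F : framework X) (z : {ffun F -> complexification X}) :
    {ffun edge F -> R[i]} :=
  let df := 'd (@edge_lengths F) (place F) in
  [ffun e => Complex (df [ffun v => (z v).1] e) (df [ffun v => (z v).2] e)].

Lemma dlengths_linear F : linear (@dlengths F).
Proof.
move=> [a b] z z'; apply/ffunP => e; rewrite /dlengths !ffunE.
set df := 'd _ _.
have -> : [ffun v => ((Complex a b *: z + z') v).1] =
  a *: [ffun v => (z v).1] - b *: [ffun v => (z v).2] + [ffun v => (z' v).1]
    :> {ffun F -> X} by apply/ffunP => v; rewrite !ffunE.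
have -> : [ffun v => ((Complex a b *: z + z') v).2] =
  a *: [ffun v => (z v).2] + b *: [ffun v => (z v).1] + [ffun v => (z' v).2]
    :> {ffun F -> X} by apply/ffunP => v; rewrite !ffunE.
by rewrite !(linearD, linearN, linearZ) /= !ffunE scalerN.
Qed.

HB.instance Definition _ (F : framework X) := GRing.isLinear.Build R[i]
  {ffun F -> complexification X} {ffun edge F -> R[i]} *:%R (@dlengths F)
  (@dlengths_linear F).

(* Values of a t outside [-1, 1] are irrelevant. *)
Definition rigid_motion (a : X -> R -> X) : Prop :=
  [/\ forall x, {within `[(-1 : R), 1], continuous (a x)},
      forall x, a x 0 = x &
      forall x y t, t \in `[(-1 : R), 1] -> `|a x t - a y t| = `|x - y|].

Definition inf_rigid_motion (eta : X -> X) : Prop :=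
  exists2 a, rigid_motion a & forall x, is_derive (0 : R) 1 (a x) (eta x).

Definition inf_rigid_motionsC : set (X -> complexification X) :=
  [set eta | exists (n : nat) (c : 'I_n -> R[i]) (xi : 'I_n -> X -> X),
    (forall k, inf_rigid_motion (xi k)) /\
    eta = \sum_(k < n) c k *: (one_tensor \o xi k)].

Definition restrict_field (F : framework X) (eta : X -> complexification X) :
    {ffun F -> complexification X} :=
  [ffun v => eta (place F v)].

Lemma restrict_field_linear F : linear (@restrict_field F).
Proof. by move=> c eta xi; apply/ffunP => v; rewrite !ffunE. Qed.

HB.instance Definition _ (F : framework X) := GRing.isLinear.Build R[i]
  (X -> complexification X) {ffun F -> complexification X} *:%R
  (@restrict_field F) (@restrict_field_linear F).

End Rigidity.

Definition symmetric_graph (Gamma : finGroupType) (G : graph)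
    (theta : Gamma -> {perm G}) : Prop :=
  [/\ forall g h v, theta (g * h)%g v = theta g (theta h v),
      forall g (e : {set G}), (theta g @: e \in edges G) = (e \in edges G) &
      forall g v, theta g v = v -> g = 1%g].

Definition isometric_representation (R : realType) (X : normedVectType R)
    (Gamma : finGroupType) (tau : Gamma -> {linear X -> X}) : Prop :=
  [/\ forall g x, `|tau g x| = `|x|,
      forall x, tau 1%g x = x &
      forall g h x, tau (g * h)%g x = tau g (tau h x)].

Record sym_framework (R : realType) (X : normedVectType R)
    (Gamma : finGroupType) := SymFramework {
  sym_base :> framework X;
  theta : Gamma -> {perm sym_base};
  tau : Gamma -> {linear X -> X};
  thetaP : symmetric_graph theta;
  tauP : isometric_representation tau;
  place_sym :
    forall g v, tau g (place sym_base v) = place sym_base (theta g v) }.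

(* The group of characters, inside the functions from Gamma to C. *)
Definition char_group (R : realType) (Gamma : finGroupType) :
    set {ffun Gamma -> R[i]} :=
  [set chi | (forall g, `|chi g| = 1) /\
             (forall g h, chi (g * h)%g = chi g * chi h)].
Arguments char_group R Gamma : clear implicits.

Section Complexes.
Context {C : nzRingType}.

(* The terms are subsets of ambient modules, on which the maps are defined; that
   they form a complex of submodules is chain_complex. *)
Record three_term (M0 M1 M2 : lmodType C) := ThreeTerm {
  term0 : set M0;
  term1 : set M1;
  term2 : set M2;
  diff0 : {linear M0 -> M1};
  diff1 : {linear M1 -> M2} }.

Definition chain_complex M0 M1 M2 (K : three_term M0 M1 M2) : Prop :=
  [/\ [/\ submod_closed [in term0 K], submod_closed [in term1 K]
        & submod_closed [in term2 K]],
      forall u, term0 K u -> term1 K (diff0 K u),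
      forall u, term1 K u -> term2 K (diff1 K u) &
      forall u, term0 K u -> diff1 K (diff0 K u) = 0].

(* The support condition keeps the sum from taking its default value 0, and
   vanishing off A makes the family of components unique as a function. *)
Definition decomposition (M : lmodType C) (I : choiceType) (A : set I)
    (S : I -> set M) (u : M) (f : I -> M) : Prop :=
  [/\ finite_set (f @^-1` [set~ 0]), forall i, ~ A i -> f i = 0,
      forall i, A i -> S i (f i) & u = \sum_(i \in A) f i].

Definition internal_direct_sum (M : lmodType C) (I : choiceType) (A : set I)
    (S : I -> set M) (W : set M) : Prop :=
  (forall i, A i -> S i `<=` W) /\
  (forall u, W u -> exists! f, decomposition A S u f).

Definition complex_direct_sum M0 M1 M2 (I : choiceType) (A : set I)
    (L : I -> three_term M0 M1 M2) (K : three_term M0 M1 M2) : Prop :=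
  [/\ [/\ chain_complex K & forall i, A i -> chain_complex (L i)],
      [/\ internal_direct_sum A (fun i => term0 (L i)) (term0 K),
          internal_direct_sum A (fun i => term1 (L i)) (term1 K) &
          internal_direct_sum A (fun i => term2 (L i)) (term2 K)],
      (forall u f, decomposition A (fun i => term0 (L i)) u f ->
         decomposition A (fun i => term1 (L i))
           (diff0 K u) (fun i => diff0 (L i) (f i))) &
      (forall u f, decomposition A (fun i => term1 (L i)) u f ->
         decomposition A (fun i => term2 (L i))
           (diff1 K u) (fun i => diff1 (L i) (f i)))].

End Complexes.

Section FrameworkComplexes.
Context {R : realType} {X : normedVectType R}.

Definition framework_complex (F : framework X) :=
  ThreeTerm inf_rigid_motionsC setT setT (@restrict_field _ _ F)
    (@dlengths _ _ F).

Context {Gamma : finGroupType} (F : sym_framework X Gamma).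
Implicit Type chi : {ffun Gamma -> R[i]}.

Definition sym_motions chi : set (X -> complexification X) :=
  [set eta | inf_rigid_motionsC eta /\
    forall g x, eta (tau F g x) = chi g *: cpx_ext (tau F g) (eta x)].

Definition sym_velocities chi : set {ffun F -> complexification X} :=
  [set x | forall g v, x (theta F g v) = chi g *: cpx_ext (tau F g) (x v)].

Definition sym_stresses chi : set {ffun edge F -> R[i]} :=
  [set y | forall g (e e' : edge F), val e' = (theta F g @: val e)%SET ->
    y e' = chi g * y e].

Definition sym_framework_complex chi :=
  ThreeTerm (sym_motions chi) (sym_velocities chi) (sym_stresses chi)
    (@restrict_field _ _ F) (@dlengths _ _ F).

End FrameworkComplexes.

(* Main.v *)
From HB Require Import structures.
Require Import Defs.
From mathcomp Require Import all_boot all_order all_fingroup all_algebra.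
From mathcomp Require Import cyclic separable cyclotomic complex.
From mathcomp Require Import all_classical all_reals all_analysis.

(** Gamma acts on velocities by (g x)_v = tau(g)^-1 x_{gv}, on motions by
   (g eta)(x) = tau(g)^-1 eta(tau(g) x) and on stresses by (g y)_e = y_{ge}, and
   the terms of the chi-symmetric complex are the chi-eigenspaces of these
   actions. A complex representation of a finite abelian group, of any
   dimension, is the direct sum of its character eigenspaces: the spectral
   projectors of one group element after the other split every vector into
   simultaneous eigenvectors, and averaging against a character extracts its
   component. The differential commutes with the actions because edge lengths
   are equivariant and the placement is fixed, and it kills rigid motions by
   the chain rule: they move the placement along a curve of constant edge
   lengths. *)

Set Implicit Arguments.
Unset Strict Implicit.
Unset Printing Implicit Defensive.

Import Order.TTheory GRing.Theory Num.Theory.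
Import numFieldNormedType.Exports.

Local Open Scope classical_set_scope.
Local Open Scope ring_scope.

(** * Roots of unity and preliminaries on modules *)

(** [X^n - 1] splits and, in characteristic 0, has [n] distinct roots; [n] distinct [n]-th roots of
    unity include a primitive one. *)
Lemma prim_root_exists (C : numClosedFieldType) n :
  (0 < n)%N -> exists z : C, n.-primitive_root z.
Proof.
move=> n_gt0; have [r Dp] := closed_field_poly_normal ('X^n - 1 : {poly C}).
rewrite (monicP _) ?monicXnsubC // scale1r in Dp.
have rn1 : all n.-unity_root r by apply/allP=> z; rewrite -root_prod_XsubC -Dp.
have sz_r : (n < (size r).+1)%N.
  by rewrite -(size_prod_XsubC r id) -Dp size_XnsubC.
have [|z] := hasP (has_prim_root n_gt0 rn1 _ sz_r); last by exists z.
by rewrite -separable_prod_XsubC -Dp separable_Xn_sub_1 // pnatr_eq0 -lt0n.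
Qed.

(** A geometric series: unless [n] divides [j], the factor [z ^+ j - 1] is nonzero, and multiplying
    by it telescopes the sum to 0. *)
Lemma sum_prim_root (C : fieldType) n (z : C) j : n.-primitive_root z ->
  \sum_(k < n) z ^+ (k * j) = (if (n %| j)%N then n%:R else 0).
Proof.
move=> zn; rewrite (eq_bigr (fun k : 'I_n => (z ^+ j) ^+ k)); last first.
  by move=> k _; rewrite mulnC exprM.
rewrite (prim_order_dvd zn); case: eqP => [->|/eqP zj1].
  rewrite (eq_bigr (fun=> 1)) ?sumr_const ?card_ord // => k _.
  by rewrite expr1n.
apply: (mulfI (_ : z ^+ j - 1 != 0)); first by rewrite subr_eq0.
by rewrite -subrX1 exprAC (prim_expr_order zn) expr1n subrr mulr0.
Qed.

Lemma sum_shift_periodic (V : zmodType) n (F : nat -> V) :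
  F n = F 0%N -> \sum_(j < n) F j.+1 = \sum_(j < n) F j.
Proof.
case: n => [|n] Fn; first by rewrite !big_ord0.
by rewrite big_ord_recr big_ord_recl /= Fn addrC.
Qed.

Lemma submod_closedP (C : nzRingType) (M : lmodType C) (W : set M) :
  submod_closed [in W] <->
  W 0 /\ forall a u v, W u -> W v -> W (a *: u + v).
Proof.
split=> [[]|[W0 WD]].
  rewrite inE => W0 WD; split=> // a u v Wu Wv.
  by have := WD a u v; rewrite !inE; exact.
by split=> [|a u v]; rewrite !inE //; exact: WD.
Qed.

Lemma scaler_injl (K : fieldType) (M : lmodType K) (v : M) :
  v != 0 -> injective (fun a : K => a *: v).
Proof.
move=> v0 a b /eqP; rewrite -subr_eq0 -scalerBl scaler_eq0 (negPf v0) orbF.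
by rewrite subr_eq0 => /eqP.
Qed.

(** * Finitely supported decompositions *)

Section DirectSums.
Context {C : nzRingType} {I : choiceType} (A : set I).

(** Both sums equal the one over all of [I], since [f] vanishes off [A] and off [r]. *)
Lemma fsumE_seq (M : lmodType C) (f : I -> M) (r : seq I) :
    uniq r -> (forall i, i \notin r -> f i = 0) ->
    (forall i, ~ A i -> f i = 0) ->
  \sum_(i \in A) f i = \sum_(i <- r) f i.
Proof.
move=> ur rf Af; rewrite [RHS]fsbig_seq //.
rewrite (@fsbig_widen _ _ _ _ A setT) //; last first.
  by move=> i [_ /Af].
rewrite [RHS](@fsbig_widen _ _ _ _ _ setT) // => i [_ /= /negP].
exact: rf.
Qed.

(** Replaces the finite support by a list that need only contain it, so that ordinary finite sums
    can be used. *)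
Lemma decompositionP (M : lmodType C) (S : I -> set M) u f :
  decomposition A S u f <->
  exists r : seq I, [/\ uniq r, forall i, i \notin r -> f i = 0,
    forall i, ~ A i -> f i = 0, forall i, A i -> S i (f i) &
    u = \sum_(i <- r) f i].
Proof.
split=> [[fin_f Af Sf ->]|[r [ur rf Af Sf ->]]].
  pose r := finmap.enum_fset (fset_set (f @^-1` [set~ 0])).
  have rf i : i \notin r -> f i = 0.
    rewrite in_fset_set// => /negP fi; apply: contrapT => fi0.
    by apply: fi; rewrite inE.
  have ur : uniq r := finmap.fset_uniq _.
  by exists r; split=> //; exact: fsumE_seq.
split=> //; last by rewrite (fsumE_seq ur).
apply: (@sub_finite_set _ _ [set` r]) => [i /= fi|]; last exact: finite_seq.
by apply/negPn/negP => /rf.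
Qed.

Lemma decomposition_linear (M N : lmodType C) (S : I -> set M) (T : I -> set N)
    (phi : {linear M -> N}) u f :
    (forall i v, A i -> S i v -> T i (phi v)) ->
  decomposition A S u f -> decomposition A T (phi u) (phi \o f).
Proof.
move=> ST /decompositionP[r [ur rf Af Sf ->]]; apply/decompositionP; exists r.
split=> //= [i /rf->|i /Af->|i Ai|]; rewrite ?linear0 ?linear_sum //.
by apply: ST => //; exact: Sf.
Qed.

End DirectSums.

(** * Character decomposition of a representation of a finite abelian group *)

Section CharacterDecomposition.
Context {R : realType} {Gamma : finGroupType} {M : lmodType R[i]}.
Context (act : Gamma -> {linear M -> M}) (W : set M).
Hypothesis abelianGamma : abelian [set: Gamma]%SET.
Hypothesis act1 : forall u, act 1%g u = u.
Hypothesis actM : forall g h u, act (g * h)%g u = act g (act h u).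
Hypothesis submodW : submod_closed [in W].
Hypothesis actW : forall g u, W u -> W (act g u).

Definition char_space (chi : {ffun Gamma -> R[i]}) : set M :=
  [set u | W u /\ forall g, act g u = chi g *: u].

Let comm_act g h u : act g (act h u) = act h (act g u).
Proof. by rewrite -!actM (centsP abelianGamma g _ h) ?inE. Qed.

Let W0 : W 0. Proof. by have /submod_closedP[] := submodW. Qed.

Let WD u v : W u -> W v -> W (u + v).
Proof.
move=> Wu Wv; have /submod_closedP[_ h] := submodW.
by rewrite -[u]scale1r; exact: h.
Qed.

Let WZ a u : W u -> W (a *: u).
Proof.
move=> Wu; have /submod_closedP[_ h] := submodW.
by rewrite -[_ *: _]addr0; exact: h.
Qed.

Let Wsum (J : Type) (r : seq J) (P : pred J) (f : J -> M) :
  (forall j, P j -> W (f j)) -> W (\sum_(j <- r | P j) f j).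
Proof. by move=> Wf; elim/big_ind : _. Qed.

(* With z a primitive root of unity of order n = #[g], w is the sum of the
   vectors n^-1 \sum_j z^(kj) g^j w for k < n, and the k-th one is an
   eigenvector of g for the eigenvalue z^-k. *)
Lemma eigenvector_sum g w : W w -> exists (n : nat) (e : 'I_n -> M),
  [/\ w = \sum_(k < n) e k, forall k, W (e k),
      forall k, exists c, act g (e k) = c *: e k &
      forall h c k, act h w = c *: w -> act h (e k) = c *: e k].
Proof.
move=> Ww; have [z zP] := prim_root_exists R[i] (order_gt0 g).
have z0 : z != 0 by rewrite (prim_root_eq0 zP) -lt0n order_gt0.
pose e k := (#[g]%g%:R^-1 : R[i]) *:
  \sum_(j < #[g]%g) z ^+ (k * j) *: act (g ^+ j)%g w.
exists #[g]%g, (fun k => e k); split.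
(* After the exchange, the sum over [k] vanishes unless [j = 0], where it is the order of [g] and
   cancels the prefactor. *)
- rewrite -scaler_sumr exchange_big /=.
  under eq_bigr => j _ do rewrite -scaler_suml sum_prim_root //.
  case: #[g]%g (order_gt0 g) => // m _.
  rewrite big_ord_recl /= expg0 act1 big1 ?addr0 => [|i _]; last first.
    by rewrite gtnNdvd ?scale0r //= /bump /= ltnS.
  by rewrite scalerA mulVf ?scale1r // pnatr_eq0.
- by move=> k; apply/WZ/Wsum => j _; apply/WZ/actW.
- move=> k; exists (z ^- k).
  rewrite linearZ scalerA mulrC -scalerA; congr (_ *: _).
  rewrite linear_sum /=.
  (* Multiplied by [z ^+ k], the claim says that shifting [j] by one leaves the sum unchanged. *)
  apply: (scalerI (_ : z ^+ k != 0)); first by rewrite expf_neq0.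
  rewrite scalerA divff ?expf_neq0 // scale1r scaler_sumr.
  pose F j := z ^+ (k * j) *: act (g ^+ j)%g w.
  rewrite (eq_bigr (fun j : 'I_#[g]%g => F j.+1)) => [|j _]; last first.
    by rewrite linearZ scalerA /F -exprD -mulnS expgS actM.
  apply: sum_shift_periodic.
  by rewrite /F muln0 expg_order mulnC exprM (prim_expr_order zP) expr1n.
- move=> h c k hw; rewrite linearZ scalerA mulrC -scalerA; congr (_ *: _).
  rewrite linear_sum scaler_sumr; apply: eq_bigr => j _.
  by rewrite linearZ comm_act hw linearZ /= !scalerA mulrC.
Qed.

(** Splitting by one element after the other keeps the pieces eigenvectors of the elements already
    treated, so that simultaneous eigenvectors remain at the end. *)
Lemma eigenvector_ind (S : set M) :
    S 0 -> (forall u v, S u -> S v -> S (u + v)) ->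
    (forall w, W w -> (forall g, exists c, act g w = c *: w) -> S w) ->
  W `<=` S.
Proof.
move=> S0 SD Seig w Ww.
(* [s] lists the elements not yet known to act on [u] by a scalar. *)
suff eigP (s : seq Gamma) u : W u ->
    (forall g, g \notin s -> exists c, act g u = c *: u) -> S u.
  by apply: (eigP (enum Gamma)) => // g; rewrite mem_enum inE.
elim: s u => [|g s IHs] u Wu eig; first by apply: Seig => // g; exact: eig.
have [n [e [uE We eg eh]]] := eigenvector_sum g Wu; rewrite uE.
elim/big_ind : _ => // k _; apply: IHs => // h hs.
have [->//|hg] := eqVneq h g.
have [|c hc] := eig h; first by rewrite inE negb_or hg.
by exists c; exact: eh.
Qed.

(** As [w] is nonzero, its eigenvalues are unique, hence multiplicative in [g]; as [g] has finite
    order, they are roots of unity and have modulus 1. *)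
Lemma eigenvector_char_space w : W w -> w != 0 ->
    (forall g, exists c, act g w = c *: w) ->
  exists2 chi, char_group R Gamma chi & char_space chi w.
Proof.
move=> Ww w0 /choice[c cP]; exists (finfun c); last first.
  by split=> // g; rewrite ffunE.
have cM g h : c (g * h)%g = c g * c h.
  apply: (scaler_injl w0).
  by rewrite -cP actM cP linearZ /= cP scalerA mulrC.
split=> [g|g h]; rewrite !ffunE //.
have c1 : c 1%g = 1 by apply: (scaler_injl w0); rewrite -cP act1 scale1r.
have cX n : c (g ^+ n)%g = c g ^+ n.
  by elim: n => [|n IHn]; rewrite ?expg0 ?expgS ?exprS ?cM ?IHn.
apply/eqP; rewrite -(@pexpr_eq1 _ _ #[g]%g) ?order_gt0 //.
by rewrite -normrX -cX expg_order c1 normr1.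
Qed.

(** The average of the action twisted by the inverse of [chi], that is, the projector onto the
    [chi]-eigenspace; it serves to prove uniqueness. *)
Definition char_proj (chi : {ffun Gamma -> R[i]}) u : M :=
  #|Gamma|%:R^-1 *: \sum_g (chi g)^-1 *: act g u.

Lemma char_proj_sum chi (J : Type) (r : seq J) (f : J -> M) :
  char_proj chi (\sum_(j <- r) f j) = \sum_(j <- r) char_proj chi (f j).
Proof.
rewrite /char_proj -scaler_sumr exchange_big; congr (_ *: _) => /=.
by apply: eq_bigr => g _; rewrite linear_sum scaler_sumr.
Qed.

Lemma char_group_neq0 chi g : char_group R Gamma chi -> chi g != 0.
Proof. by case=> chi1 _; rewrite -normr_eq0 chi1 oner_eq0. Qed.

(** Orthogonality of characters: for [psi] other than [chi], translation by a suitable [h]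
    multiplies the sum of [psi g / chi g] by a factor different from 1, so the sum is 0. *)
Lemma char_projE chi psi u : char_group R Gamma chi -> char_group R Gamma psi ->
  char_space psi u -> char_proj chi u = if psi == chi then u else 0.
Proof.
move=> chiP psiP [_ psiu].
rewrite /char_proj (eq_bigr (fun g => (psi g / chi g) *: u)); last first.
  by move=> g _; rewrite psiu scalerA mulrC.
rewrite -scaler_suml scalerA.
have nzG : #|Gamma|%:R != 0 :> R[i].
  by rewrite pnatr_eq0 -lt0n; apply/card_gt0P; exists 1%g.
case: eqVneq => [->|psichi].
  rewrite (eq_bigr (fun=> 1)) => [|g _]; last by rewrite divff ?char_group_neq0.
  by rewrite sumr_const mulVf ?scale1r.
have [h hP] : exists h, psi h / chi h != 1.
  apply/existsP; apply: contraNT psichi; rewrite negb_exists => /forallP eqP1.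
  apply/eqP/ffunP => h; have := eqP1 h; rewrite negbK => /eqP.
  by move/(canRL (divfK (char_group_neq0 h chiP))); rewrite mul1r.
suff -> : \sum_g psi g / chi g = 0 by rewrite mulr0 scale0r.
apply: (mulfI (_ : psi h / chi h - 1 != 0)); first by rewrite subr_eq0.
rewrite mulr0 mulrBl mul1r mulr_sumr; apply/eqP; rewrite subr_eq0; apply/eqP.
rewrite [RHS](reindex_inj (mulgI h)); apply: eq_bigr => g _ /=.
by rewrite (proj2 chiP) (proj2 psiP) invfM mulrACA.
Qed.

(** Components exist because simultaneous eigenvectors each lie in one eigenspace; they are unique
    because [char_proj] recovers them from any decomposition. *)
Lemma char_internal_direct_sum :
  internal_direct_sum (char_group R Gamma) char_space W.
Proof.
split=> [chi _ u []//|u Wu].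
(* Serves for the zero vector in the induction and again for an eigenvector [w = 0], which
   determines no character. *)
have dec0 : exists f, decomposition (char_group R Gamma) char_space 0 f.
  exists (fun=> 0); apply/decompositionP; exists [::].
  split=> // [chi _|]; rewrite ?big_nil //.
  by split=> // g; rewrite linear0 scaler0.
have [f fP] : exists f, decomposition (char_group R Gamma) char_space u f.
  move: u Wu; apply: eigenvector_ind => [|u v|w Ww eigw].
  - exact: dec0.
  - move=> [f /decompositionP[r [ur rf Af Sf ->]]].
    move=> [f' /decompositionP[r' [ur' rf' Af' Sf' ->]]].
    (* The two supports may overlap, so duplicates are removed from the joint list. *)
    exists (f \+ f'); apply/decompositionP; exists (undup (r ++ r')).
    split=> [|i|i Ai|i Ai|].
    + exact: undup_uniq.
    + rewrite mem_undup mem_cat negb_or /= => /andP[/rf-> /rf'->].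
      by rewrite addr0.
    + by rewrite /= Af ?Af' ?addr0.
    + have [[Wf fi] [Wf' fi']] := (Sf i Ai, Sf' i Ai).
      by split=> [|g]; [exact: WD|rewrite linearD fi fi' scalerDr].
    + rewrite big_split /=; congr (_ + _).
        rewrite -(@fsumE_seq _ _ _ _ _ r ur rf Af).
        apply: fsumE_seq => // [|i].
          exact: undup_uniq.
        by rewrite mem_undup mem_cat negb_or => /andP[/rf].
      rewrite -(@fsumE_seq _ _ _ _ _ r' ur' rf' Af').
      apply: fsumE_seq => // [|i].
        exact: undup_uniq.
      by rewrite mem_undup mem_cat negb_or => /andP[_ /rf'].
  - have [->|w0] := eqVneq w 0; first exact: dec0.
    have [chi chiP chiw] := eigenvector_char_space Ww w0 eigw.
    exists (fun i => if i == chi then w else 0); apply/decompositionP.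
    exists [:: chi]; split=> // [i|i Ai|i Ai|]; rewrite ?big_seq1 ?eqxx ?inE //.
    + by move/negPf->.
    + by case: eqP Ai => // ->.
    + case: eqP => [->//|_]; split=> // g; first by rewrite linear0 scaler0.
exists f; split=> // f' f'P; apply/funext => chi.
(* Off the characters both families vanish by definition, which makes them equal as functions. *)
have [chiP|nchi] := pselect (char_group R Gamma chi); last first.
  by case: fP f'P => _ + _ _ [_ + _ _] => -> // ->.
suff fE (h : _ -> M) : decomposition (char_group R Gamma) char_space u h ->
  h chi = char_proj chi u by rewrite !fE.
case/decompositionP => r [ur rh Ah Sh ->]; rewrite char_proj_sum.
rewrite (eq_bigr (fun psi => if psi == chi then h psi else 0)) => [|psi _];
    last first.
  have [psiP|npsi] := pselect (char_group R Gamma psi).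
    exact: char_projE (Sh _ psiP).
  rewrite Ah // if_same /char_proj big1 ?scaler0 // => g _.
  by rewrite linear0 scaler0.
(* If [chi] is in [r], it occurs exactly once; otherwise both sides are 0. *)
rewrite -big_mkcond /=; have [chir|chir] := boolP (chi \in r).
  rewrite (big_rem chi) //= ifT // big_seq_cond big1 ?addr0 // => psi.
  by case/andP => + /eqP psiE; rewrite psiE mem_rem_uniqF.
rewrite rh // big_seq_cond big1 // => psi.
by case/andP => + /eqP psiE; rewrite psiE (negPf chir).
Qed.

End CharacterDecomposition.

(** * Componentwise limits and derivatives *)

(** Finitely many componentwise estimates hold simultaneously, and together they bound the sup
    norm. *)
Lemma cvg_ffunP (R : realType) (I : finType) (X : normedModType R) (T : Type)
    (D : set_system T) (FD : Filter D) (f : T -> {ffun I -> X})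
    (l : {ffun I -> X}) :
  f @ D --> l <-> forall i, (fun t => f t i) @ D --> l i.
Proof.
split=> [/cvgrPdist_lt fl i|fl]; apply/cvgrPdist_lt => e e0.
  apply: filterS (fl _ e0) => t; apply: le_lt_trans.
  have := le_bigmax _ (fun i => `|(l - f t) i|) i.
  by rewrite /= !ffunE; exact.
suff: \forall t \near D, forall i, `|l i - f t i| < e.
  apply: filterS => t lt_e; apply/bigmax_ltP; split=> // i _.
  by rewrite !ffunE.
by apply: filter_forall => i; have /cvgrPdist_lt := fl i; exact.
Qed.

Lemma is_deriveP (R : numFieldType) (V W : normedModType R) (f : V -> W)
    a v df :
  is_derive a v f df <->
  (fun h : R => h^-1 *: (f (h *: v + a) - f a)) @ 0^' --> df.
Proof.
split=> [[fa <-]|cv]; first exact: fa.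
by apply: DeriveDef; [exact: cvgP cv|exact: cvg_lim cv].
Qed.

Lemma is_derive_ffun (R : realType) (V X : normedModType R) (I : finType)
    (f : V -> {ffun I -> X}) a v df :
  is_derive a v f df <-> forall i, is_derive a v (f^~ i) (df i).
Proof.
rewrite is_deriveP cvg_ffunP.
split=> fi i; [apply/is_deriveP|have /is_deriveP := fi i].
  by have := fi i; under [X in X @ _]eq_fun do rewrite !ffunE.
by under [X in _ -> X @ _ --> _]eq_fun do rewrite !ffunE.
Qed.

Lemma linear_isometry_continuous (R : realType) (X Y : normedModType R)
  (f : {linear X -> Y}) : (forall x, `|f x| = `|x|) -> continuous f.
Proof.
move=> isof x; apply/cvgrPdist_lt => e e0.
have /cvgrPdist_lt/(_ _ e0) : y @[y --> x] --> x by exact: cvg_id.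
by apply: filterS => y; rewrite -linearB isof.
Qed.

(** * Rigid motions and their effect on edge lengths *)

Section RigidMotions.
Context {R : realType} {X : normedVectType R}.

(** The paths [f \o a (g x)] again form a rigid motion; [f], being linear and continuous, commutes
    with difference quotients and their limits. *)
Lemma inf_rigid_motion_conj (f g : {linear X -> X}) xi :
    (forall x, `|f x| = `|x|) -> (forall x, `|g x| = `|x|) -> cancel g f ->
  inf_rigid_motion xi -> inf_rigid_motion (f \o xi \o g).
Proof.
move=> isof isog gK [a [acont a0 aiso] xiE].
have fcont := linear_isometry_continuous isof.
exists (fun x => f \o a (g x)); first split=> [x|x|x y t tI].
- by move=> t; exact: continuous_cvg (fcont _) (acont (g x) t).
- by rewrite /= a0 gK.
- by rewrite /= -linearB isof aiso // -linearB isog.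
move=> x; apply/is_deriveP; have /is_deriveP aE := xiE (g x).
rewrite (_ : (fun h : R => _) = f \o fun h =>
    h^-1 *: (a (g x) (h *: 1 + 0) - a (g x) 0)); last first.
  by apply/funext => h; rewrite [RHS]linearZ [in RHS]linearB.
exact: continuous_cvg (fcont _) aE.
Qed.

Lemma diff_edge_lengths_rigid (F : framework X) xi :
    well_positioned F -> inf_rigid_motion xi ->
  'd (@edge_lengths _ _ F) (place F) [ffun v => xi (place F v)] = 0.
Proof.
move=> wpF [a [acont a0 aiso] xiE].
pose c t : {ffun F -> X} := [ffun v => a (place F v) t].
have c0 : c 0 = place F by apply/ffunP => v; rewrite ffunE a0.
have [cD cE] : is_derive (0 : R) 1 c [ffun v => xi (place F v)].
  by apply/is_derive_ffun => v; rewrite ffunE; under eq_fun do rewrite ffunE.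
have diffc : differentiable c 0 by apply/derivable1_diffP.
have diffl : differentiable (@edge_lengths _ _ F) (c 0) by rewrite c0.
(* The chain rule for edge lengths along [c], evaluated at the tangent vector 1. *)
have dlc := congr1 (fun phi : R -> _ => phi 1) (diff_comp diffc diffl).
rewrite -cE (deriveE _ diffc) -c0 -[LHS]dlc.
rewrite -deriveE; last exact: differentiable_comp.
(* Edge lengths along [c] are known to be constant on [[-1, 1]] only, but the derivative at 0 is
   local. *)
apply: etrans (near_eq_derive _ _) (derive_cst (edge_lengths (place F)) _ _).
have : \forall t \near (0 : R), t \in `[(-1 : R), 1].
  have := @near_in_itvoo R (-1) 1 0.
  rewrite in_itv /= ltrN10 ltr01 => /(_ isT).
  by apply: filterS => t; rewrite !in_itv /= => /andP[/ltW-> /ltW->].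
apply: filterS => t tI; apply/ffunP => e /=; rewrite !ffunE.
by case: (ends e) => // -[v w]; rewrite !ffunE aiso.
Qed.

(** Two complex combinations are concatenated; the motions themselves are never added. Zero is the
    empty combination. *)
Lemma inf_rigid_motionsC_submod : submod_closed [in @inf_rigid_motionsC R X].
Proof.
apply/submod_closedP; split.
  by exists 0%N, (fun=> 0), (fun=> id); split=> [[]//|]; rewrite big_ord0.
move=> a _ _ [n [c [xi [xiP ->]]]] [n' [c' [xi' [xiP' ->]]]].
exists (n + n')%N.
exists (fun k : 'I_(n + n') =>
  match fintype.split k with inl i => a * c i | inr i => c' i end).
exists (fun k : 'I_(n + n') =>
  match fintype.split k with inl i => xi i | inr i => xi' i end).
split=> [k|]; first by case: fintype.split.
rewrite big_split_ord scaler_sumr; congr (_ + _); apply: eq_bigr => k _.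
  by rewrite (unsplitK (inl k)) scalerA.
by rewrite (unsplitK (inr k)).
Qed.

(** By linearity it suffices to treat one real field, whose imaginary part is 0. *)
Lemma dlengths_restrict (F : framework X) eta :
  well_positioned F -> inf_rigid_motionsC eta ->
  dlengths (restrict_field F eta) = 0.
Proof.
move=> wpF [n [c [xi [xiP ->]]]]; rewrite !linear_sum big1 // => k _.
rewrite !linearZ /=; set z := restrict_field _ _.
have z1 : [ffun v => (z v).1] = [ffun v => xi k (place F v)].
  by apply/ffunP => v; rewrite !ffunE.
have z2 : [ffun v => (z v).2] = 0 by apply/ffunP => v; rewrite !ffunE.
suff -> : dlengths z = 0 by rewrite scaler0.
apply/ffunP => e; rewrite !ffunE z1 z2 diff_edge_lengths_rigid // linear0.
by rewrite ffunE.
Qed.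

End RigidMotions.

(** * Equivariance of edge lengths and the actions of the group *)

Lemma edge_ends (G : graph) (e : edge G) : exists v w, val e = [set v; w]%SET.
Proof.
by have /eqP/cards2P[v [w [_ evw]]] := edges_card2 (valP e); exists v, w.
Qed.

Section SymmetricFramework.
Context {R : realType} {X : normedVectType R} {Gamma : finGroupType}.
Context (F : sym_framework X Gamma).
Local Notation tau := (tau F).
Local Notation theta := (theta F).

Lemma tau_iso g x : `|tau g x| = `|x|. Proof. by case: (tauP F). Qed.
Lemma tau1 x : tau 1%g x = x. Proof. by case: (tauP F). Qed.
Lemma tauM g h x : tau (g * h)%g x = tau g (tau h x).
Proof. by case: (tauP F). Qed.
Lemma tauK g : cancel (tau g) (tau g^-1%g).
Proof. by move=> x; rewrite -tauM mulVg tau1. Qed.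
Lemma thetaM g h v : theta (g * h)%g v = theta g (theta h v).
Proof. by case: (thetaP F). Qed.
(** [theta 1%g] is injective and idempotent. *)
Lemma theta1 v : theta 1%g v = v.
Proof. by apply: (@perm_inj _ (theta 1%g)); rewrite -thetaM mulg1. Qed.

Lemma edge_lengths_sym g (e e' : edge F) (x x' : {ffun F -> X}) :
    val e' = (theta g @: val e)%SET ->
    (forall v, x' (theta g v) = tau g (x v)) ->
  edge_lengths x' e' = edge_lengths x e.
Proof.
move=> ee' xx'; have [v [w evw]] := edge_ends e.
rewrite (edge_lengthsE x evw).
rewrite (@edge_lengthsE _ _ _ x' e' (theta g v) (theta g w)).
  by rewrite !xx' -linearB tau_iso.
by rewrite ee' evw imsetU1 imset_set1.
Qed.

(** The element [g] fixes the placement and carries its displacement by [h *: x] to that by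
    [h *: x'], so the difference quotients agree for every [h]. *)
Lemma diff_edge_lengths_sym g (e e' : edge F) (x x' : {ffun F -> X}) :
    well_positioned F ->
    val e' = (theta g @: val e)%SET ->
    (forall v, x' (theta g v) = tau g (x v)) ->
  'd (@edge_lengths _ _ F) (place F) x' e' =
  'd (@edge_lengths _ _ F) (place F) x e.
Proof.
move=> wpF ee' xx'.
pose quot y e0 (h : R) : R :=
  h^-1 *: (edge_lengths (h *: y + place F) e0 - edge_lengths (place F) e0).
have diffE y e0 :
    'd (@edge_lengths _ _ F) (place F) y e0 = lim (quot y e0 @ 0^').
  have : is_derive (place F) y (@edge_lengths _ _ F)
      ('d (@edge_lengths _ _ F) (place F) y).
    by apply: DeriveDef; [exact: diff_derivable|exact: deriveE].
  by move/is_derive_ffun/(_ e0)/is_deriveP => cv; apply/esym/cvg_lim.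
rewrite !diffE; suff -> : quot x' e' = quot x e by [].
apply/funext => h; rewrite /quot.
rewrite (edge_lengths_sym ee' (x := h *: x + place F)) => [|v]; last first.
  by rewrite !ffunE xx' linearP place_sym.
by rewrite (edge_lengths_sym ee' (x := place F)) // => v; rewrite place_sym.
Qed.

Lemma cpx_ext_linear (f : {linear X -> X}) : linear (cpx_ext f).
Proof.
by move=> c z z'; congr (_, _); rewrite /= linearD ?linearB ?linearD !linearZ.
Qed.

HB.instance Definition _ (f : {linear X -> X}) := GRing.isLinear.Build R[i]
  (complexification X) (complexification X) *:%R (cpx_ext f) (cpx_ext_linear f).

(** Dividing [x] by [chi g] turns the symmetry of [x] into plain equivariance, which applies to real
    and imaginary parts separately. *)
Lemma sym_stresses_dlengths chi x :
  well_positioned F -> char_group R Gamma chi ->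
  sym_velocities (F := F) chi x -> sym_stresses chi (dlengths x).
Proof.
move=> wpF chiP xchi g e e' ee'.
have chi0 := char_group_neq0 g chiP.
rewrite -[in LHS](scalerKV chi0 x) linearZ ffunE; congr (_ * _).
have xE v : ((chi g)^-1 *: x) (theta g v) = cpx_ext (tau g) (x v).
  by rewrite !ffunE xchi scalerK.
by rewrite !ffunE; congr Complex; apply: (diff_edge_lengths_sym wpF ee') => v;
   rewrite ffunE xE ffunE.
Qed.

(* This is a left action, like the two below, only because Gamma is abelian. *)
Definition velocity_act g (x : {ffun F -> complexification X}) :
    {ffun F -> complexification X} :=
  [ffun v => cpx_ext (tau g^-1%g) (x (theta g v))].

Definition motion_act g (eta : X -> complexification X) :
    X -> complexification X :=
  fun x => cpx_ext (tau g^-1%g) (eta (tau g x)).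

Lemma edge_act_subproof g (e : edge F) : (theta g @: val e)%SET \in edges F.
Proof. by case: (thetaP F) => _ -> _; exact: valP. Qed.

Definition edge_act g (e : edge F) : edge F :=
  exist (fun e => e \in edges F) _ (edge_act_subproof g e).

Definition stress_act g (y : {ffun edge F -> R[i]}) : {ffun edge F -> R[i]} :=
  [ffun e => y (edge_act g e)].

Lemma velocity_act_linear g : linear (velocity_act g).
Proof. by move=> c x y; apply/ffunP => v; rewrite !ffunE linearP. Qed.

Lemma motion_act_linear g : linear (motion_act g).
Proof. by move=> c x y; apply/funext => v; rewrite /motion_act linearP. Qed.

Lemma stress_act_linear g : linear (stress_act g).
Proof. by move=> c x y; apply/ffunP => v; rewrite !ffunE. Qed.

HB.instance Definition _ g := GRing.isLinear.Build R[i]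
  _ _ *:%R (velocity_act g) (velocity_act_linear g).
HB.instance Definition _ g := GRing.isLinear.Build R[i]
  _ _ *:%R (motion_act g) (motion_act_linear g).
HB.instance Definition _ g := GRing.isLinear.Build R[i]
  _ _ *:%R (stress_act g) (stress_act_linear g).

Lemma cpx_ext_tau1 z : cpx_ext (tau 1%g) z = z.
Proof. by case: z => x y; rewrite /cpx_ext /= !tau1. Qed.

Lemma cpx_ext_tauM g h z :
  cpx_ext (tau (g * h)%g) z = cpx_ext (tau g) (cpx_ext (tau h) z).
Proof. by rewrite /cpx_ext /= !tauM. Qed.

Lemma cpx_ext_tauK g : cancel (cpx_ext (tau g)) (cpx_ext (tau g^-1%g)).
Proof. by move=> z; rewrite -cpx_ext_tauM mulVg cpx_ext_tau1. Qed.

(** Translates between the eigenvector equations of the actions and the symmetry conditions. *)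
Lemma cpx_ext_tau_eq g (c : R[i]) z w :
  cpx_ext (tau g^-1%g) w = c *: z <-> w = c *: cpx_ext (tau g) z.
Proof.
split=> [E|->]; last by rewrite linearZ /= cpx_ext_tauK.
by rewrite -linearZ /= -E -cpx_ext_tauM mulgV cpx_ext_tau1.
Qed.

(** The coefficients stay, and each real field is conjugated by the isometry [tau g]. *)
Lemma inf_rigid_motionsC_act g eta :
  inf_rigid_motionsC eta -> inf_rigid_motionsC (motion_act g eta).
Proof.
move=> [n [c [xi [xiP ->]]]].
exists n, c, (fun k => tau g^-1%g \o xi k \o tau g); split=> [k|].
  by apply: inf_rigid_motion_conj (xiP k);
    [exact: tau_iso|exact: tau_iso|exact: tauK].
rewrite linear_sum; apply: eq_bigr => k _; rewrite linearZ; congr (_ *: _).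
by apply/funext => x; congr (_, _); rewrite /= linear0.
Qed.

(** * Decomposition of the three terms *)

Hypothesis abelianGamma : abelian [set: Gamma]%SET.

Let mulgC (g h : Gamma) : (g * h)%g = (h * g)%g.
Proof. by apply: (centsP abelianGamma); rewrite inE. Qed.

Lemma velocities_direct_sum :
  internal_direct_sum (char_group R Gamma) (sym_velocities (F := F)) setT.
Proof.
rewrite (_ : @sym_velocities _ _ _ F = char_space velocity_act setT).
  apply: char_internal_direct_sum => //.
  - by move=> x; apply/ffunP => v; rewrite ffunE invg1 cpx_ext_tau1 theta1.
  (* Composing the actions yields [theta (h * g)] on vertices and [tau (g^-1 * h^-1)] on vectors, so
     commutativity enters twice. *)
  - move=> g h x; apply/ffunP => v.
    by rewrite !ffunE invMg -thetaM -cpx_ext_tauM mulgC (mulgC h^-1%g).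
  - exact/submod_closedP.
apply/funext => chi; apply/seteqP; split=> [x xchi|x [_ xchi] g v].
  split=> // g; apply/ffunP => v; rewrite !ffunE.
  by apply/cpx_ext_tau_eq; exact: xchi.
by apply/cpx_ext_tau_eq; have /ffunP/(_ v) := xchi g; rewrite !ffunE.
Qed.

Lemma motions_direct_sum :
  internal_direct_sum (char_group R Gamma) (sym_motions F)
    (@inf_rigid_motionsC R X).
Proof.
rewrite (_ : @sym_motions _ _ _ F =
    char_space motion_act (@inf_rigid_motionsC R X)).
  apply: char_internal_direct_sum => //.
  - move=> x; apply/funext => v.
    by rewrite /= /motion_act invg1 cpx_ext_tau1 tau1.
  - move=> g h x; apply/funext => v.
    by rewrite /= /motion_act invMg -tauM -cpx_ext_tauM mulgC (mulgC h^-1%g).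
  - exact: inf_rigid_motionsC_submod.
  - exact: inf_rigid_motionsC_act.
apply/funext => chi; apply/seteqP; split=> [x [Wx xchi]|x [Wx xchi]].
  by split=> // g; apply/funext => v; apply/cpx_ext_tau_eq; exact: xchi.
split=> // g v; apply/cpx_ext_tau_eq.
by have /(congr1 (fun eta => eta v)) := xchi g.
Qed.

Lemma stresses_direct_sum :
  internal_direct_sum (char_group R Gamma) (sym_stresses (F := F)) setT.
Proof.
rewrite (_ : @sym_stresses _ _ _ F = char_space stress_act setT).
  apply: char_internal_direct_sum => //.
  - move=> x; apply/ffunP => e; rewrite ffunE; congr (x _); apply/val_inj => /=.
    by rewrite (eq_imset _ theta1) imset_id.
  - move=> g h x; apply/ffunP => e.
    rewrite !ffunE; congr (x _); apply/val_inj => /=.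
    by rewrite -imset_comp mulgC; apply: eq_imset => v; exact: thetaM.
  - exact/submod_closedP.
apply/funext => chi; apply/seteqP; split=> [y ychi|y [_ ychi] g e e' ee'].
  by split=> // g; apply/ffunP => e; rewrite !ffunE; exact: ychi.
have -> : e' = edge_act g e by exact: val_inj.
by have /ffunP/(_ e) := ychi g; rewrite !ffunE.
Qed.

Lemma sym_complex_chain chi : well_positioned F -> char_group R Gamma chi ->
  chain_complex (sym_framework_complex F chi).
Proof.
move=> wpF chiP; split=> /=.
- split; apply/submod_closedP; split.
  + have /submod_closedP[W0 _] := @inf_rigid_motionsC_submod R X.
    by split=> // g x; rewrite linear0 scaler0.
  + have /submod_closedP[_ WD] := @inf_rigid_motionsC_submod R X.
    move=> a u v [Wu uchi] [Wv vchi]; split=> [|g x]; first exact: WD.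
    rewrite -[LHS]/(a *: u (tau g x) + v (tau g x)) uchi vchi.
    by rewrite [in RHS]linearP scalerDr !scalerA [a * _]mulrC.
  + by move=> g v; rewrite !ffunE linear0 scaler0.
  + move=> a u v uchi vchi g x.
    by rewrite !ffunE uchi vchi linearP scalerDr !scalerA [a * _]mulrC.
  + by move=> g e e' _; rewrite !ffunE mulr0.
  + move=> a u v uchi vchi g e e' ee'.
    rewrite !ffunE (uchi g e) // (vchi g e) // mulrDr; congr (_ + _).
    exact: mulrCA.
(* Symmetry of [eta] at the point of [v] becomes symmetry of the restriction, as [tau g] moves that
   point to the one of [theta g v]. *)
- by move=> eta [_ etachi] g v; rewrite !ffunE -place_sym etachi.
- by move=> x; exact: sym_stresses_dlengths.
- by move=> eta [Weta _]; exact: dlengths_restrict.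
Qed.

End SymmetricFramework.

Theorem theorem2p8 (R : realType) (X : normedVectType R)
    (dimX : (2 <= \dim (fullv : {vspace X}))%N)
    (Gamma : finGroupType) (abelianGamma : abelian [set: Gamma]%SET)
    (F : sym_framework X Gamma) (wpF : well_positioned F) :
  complex_direct_sum (char_group R Gamma) (sym_framework_complex F)
    (framework_complex F).
Proof.
have Lchain := fun chi => @sym_complex_chain _ _ _ F chi wpF.
split.
- split=> //; split=> //=; last by move=> eta; exact: dlengths_restrict.
  split; [exact: inf_rigid_motionsC_submod|exact/submod_closedP..].
- by split; [exact: motions_direct_sum|exact: velocities_direct_sum|
             exact: stresses_direct_sum].
(* Each differential carries a [chi]-term into the next one, so it maps decompositions to
   decompositions. *)
- move=> eta f; apply: decomposition_linear => chi u /Lchain[_ + _ _].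
  exact.
- move=> x f; apply: decomposition_linear => chi u /Lchain[_ _ + _].
  exact.
Qed.
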